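(* Let $G$ be a finite group and let $p$ be a prime dividing $|G|$. Let $e = \operatorname{ord}_p |G|$, and let $f$ be the maximum of $\operatorname{ord}_p \langle \chi, \chi\rangle$ as $\chi$ ranges over the unramified irreducible characters of $G$ (at $p$). If $g_1, g_2 \in G$ are such that $\chi(g_1) \equiv \chi(g_2) \mod p^{e+f+1}$ for all unramified irreducible characters $\chi$ of $G$, then $g_1$ and $g_2$ are $\Gamma$-conjugate.
   Context: $\operatorname{ord}_p$ is the $p$-adic valuation. Write $|G| = r p^e$ with $r$ prime to $p$, and let $\Gamma$ be the kernel of the projection $(\mathbb{Z}/|G|\mathbb{Z})^\times \to (\mathbb{Z}/r\mathbb{Z})^\times$. Two elements of $G$ are $\Gamma$-conjugate if they are equivalent under the equivalence relation on $G$ generated by conjugation and $x \sim x^s$ for $s \in \Gamma$. For a complex character $\chi$ of $G$, $\mathbb{Q}(\chi)$ is the field generated over $\mathbb{Q}$ by the values of $\chi$; $\chi$ is unramified at $p$ if $\mathbb{Q}(\chi)/\mathbb{Q}$ is unramified at $p$ (equivalently, $\chi$ is constant on $\Gamma$-conjugacy classes). The group $\Gamma$ acts on the complex irreducible characters of $G$ by $\chi^s(g) = \chi(g^s)$. The unramified irreducible characters of $G$ are the sums of the $\Gamma$-orbits of complex irreducible characters (each orbit sum counting every character in the orbit once); they form a basis of the ring of characters of $G$ unramified at $p$. $\langle \phi, \psi\rangle = \frac{1}{|G|}\sum_{g \in G} \phi(g)\psi(g^{-1})$ is the usual inner product of class functions. For algebraic integers $a,b$, $a \equiv b \mod p^m$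 means that $(a-b)/p^m$ is an algebraic integer. *)

(* Defs.v *)
From mathcomp Require Import all_boot all_order all_algebra all_fingroup.
From mathcomp Require Import all_solvable all_field all_character.

Set Implicit Arguments.
Unset Strict Implicit.
Unset Printing Implicit Defensive.

Import Order.TTheory GRing.Theory Num.Theory.
Local Open Scope group_scope.
Local Open Scope ring_scope.

Section GammaConjugacy.

Variables (gT : finGroupType) (G : {group gT}) (p : nat).

(* #|G|`_p^' is the prime-to-p part r of #|G|. The kernel condition is written
   as a congruence of representatives because 'Z_1 is not the trivial ring,
   so a map to {unit 'Z_r} would be wrong for r = 1; similarly 'Z_#|G| is the
   ring of integers modulo #|G| only when #|G| > 1. *)
Definition Gamma : {set {unit 'Z_#|G|}} :=
  [set s : {unit 'Z_#|G|} | (val s : nat) == 1 %[mod #|G|`_p^']]%N.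

Definition Gamma_step : rel gT := fun x y =>
  (x \in G) && ([exists h in G, y == (x ^ h)%g]
                || [exists s in Gamma, y == (x ^+ (val s : nat))%g]).

(* connect is the reflexive transitive closure, so this is the equivalence
   relation generated by Gamma_step. *)
Definition Gamma_conj : rel gT :=
  connect [rel x y | Gamma_step x y || Gamma_step y x].

Fact cfPow_subproof (phi : 'CF(G)) (s : nat) :
  is_class_fun <<G>> [ffun x => phi (x ^+ s)%g *+ (x \in G)].
Proof.
rewrite genGid; apply: intro_class_fun => [x y Gx Gy | x /negPf-> //].
by rewrite groupJ // -conjXg cfunJ ?groupX // Gx.
Qed.
Definition cfPow (phi : 'CF(G)) (s : nat) : 'CF(G) :=
  Cfun 0 (cfPow_subproof phi s).

Lemma cfPowE phi s x : x \in G -> cfPow phi s x = phi (x ^+ s)%g.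
Proof. by move=> Gx; rewrite cfunE Gx. Qed.

Definition Gamma_orbit (i : Iirr G) : {set Iirr G} :=
  [set j | [exists s in Gamma, 'chi_j == cfPow 'chi_i (val s : nat)]].

Definition unramified_irr (i : Iirr G) : 'CF(G) :=
  \sum_(j in Gamma_orbit i) 'chi_j.

Definition unramified_norm_ord (i : Iirr G) : nat :=
  logn p (Num.truncn '[unramified_irr i]).

Definition max_unramified_norm_ord : nat :=
  \max_(i : Iirr G) unramified_norm_ord i.

Lemma unramified_irr_char i : unramified_irr i \is a character.
Proof. by apply: rpred_sum => j _; apply: irr_char. Qed.

(* Num.truncn in unramified_norm_ord loses nothing. *)
Lemma unramified_norm_nat i :
  (Num.truncn '[unramified_irr i])%:R = '[unramified_irr i].
Proof. by rewrite truncnK // Cnat_cfdot_char ?unramified_irr_char. Qed.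

(* MathComp's '[_, _] conjugates the second value; on characters this is the
   form with psi (g^-1). *)
Lemma cfdot_charV (phi psi : 'CF(G)) : psi \is a character ->
  '[phi, psi] = #|G|%:R^-1 * \sum_(g in G) phi g * psi g^-1%g.
Proof.
by move=> Npsi; rewrite cfdotE; congr (_ * _); apply: eq_bigr => g _;
  rewrite char_inv.
Qed.

End GammaConjugacy.

(* Main.v *)
Require Import Defs.
From mathcomp Require Import all_boot all_order all_algebra all_fingroup.
From mathcomp Require Import all_solvable all_field all_character.
From mathcomp Require Import ring.

(** Let C be the Gamma-conjugacy class of g1 and phi its indicator function.
Power maps x |-> x ^+ s with s in Gamma permute C, so the coefficient
'[phi, 'chi_i] depends only on the Gamma-orbit O_i of 'chi_i. Regrouping the
expansion of phi over irreducible characters by orbits gives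
[[
  phi = \sum_i ('[phi, 'chi_i] / #|O_i|) *: unramified_irr p i
]]
(lemma [unramified_expansion]), where the sum is over all irreducible
characters, each orbit sum being repeated #|O_i| times. Here #|O_i| is the norm
of the orbit sum, so its p-adic valuation is at most f, and some N with
logn p N = f is divisible by all the #|O_i|.

If g2 were not in C, then evaluating at g1 and at g2 and subtracting would give
[[
  N * #|G| = \sum_i (N / #|O_i|) * (#|G| * '[phi, 'chi_i])
                 * (unramified_irr p i g1 - unramified_irr p i g2).
]]
The first factor is an integer, the second is an algebraic integer because
#|G| * '[phi, 'chi_i] is a sum of character values, and the third is divisible
by p ^ (e + f + 1) by assumption. Hence p ^ (e + f + 1) divides N * #|G| among
the algebraic integers, therefore among the integers, whereas the p-adic
valuation of N * #|G| is only e + f. *)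

Set Implicit Arguments.
Unset Strict Implicit.
Unset Printing Implicit Defensive.
Import Order.TTheory GRing.Theory Num.Theory.
Local Open Scope ring_scope.

(** A common multiple of the d i that costs no more at p than the bound f: the
prime-to-p parts can be multiplied together without affecting logn p. *)
Lemma common_multiple_logn (I : finType) (p f : nat) (d : I -> nat) :
  prime p -> (forall i, 0 < d i)%N -> (forall i, logn p (d i) <= f)%N ->
  exists2 N, (0 < N)%N /\ logn p N = f & forall i, (d i %| N)%N.
Proof.
move=> p_pr d_gt0 le_f; exists (p ^ f * \prod_i (d i)`_p^')%N.
  have p'm: p^'.-nat (\prod_i (d i)`_p^')%N.
    by elim/big_ind: _ => [//|m n p'm p'n|i _]; rewrite ?part_pnat // pnatM p'm.
  have [m_gt0 _] := andP p'm.
  split; first by rewrite muln_gt0 expn_gt0 prime_gt0.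
  rewrite lognM ?expn_gt0 ?(prime_gt0 p_pr) // pfactorK // [X in (_ + X)%N]lognE.
  by rewrite p_pr m_gt0 (negPf (_ : ~~ (p %| _)%N)) ?addn0 // -p'natE.
move=> i; rewrite -{1}(partnC p (d_gt0 i)) dvdn_mul //.
  by rewrite p_part dvdn_exp2l.
by rewrite (bigD1 i) //= dvdn_mulr.
Qed.

Section GammaOrbits.

Variables (gT : finGroupType) (G : {group gT}) (p : nat).
Hypothesis G_gt1 : (1 < #|G|)%N.

Lemma val_unit_ZpM (s t : {unit 'Z_#|G|}) :
  (val (s * t)%g : nat) = (val s * val t)%N %[mod #|G|].
Proof. by rewrite /=; move: (_ * _)%N => /= k; rewrite Zp_cast // modn_mod. Qed.

Lemma expg_unit_Zp1 (x : gT) : (x ^+ (val (1%g : {unit 'Z_#|G|}) : nat) = x)%g.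
Proof. by rewrite /= modn_small ?expg1 // Zp_cast. Qed.

Lemma expg_unit_ZpM x (s t : {unit 'Z_#|G|}) : x \in G ->
  (x ^+ (val (s * t)%g : nat) = (x ^+ (val s : nat)) ^+ (val t : nat))%g.
Proof.
move=> Gx; rewrite -expgM; apply/eqP.
rewrite eq_expg_mod_order -(modn_dvdm _ (order_dvdG Gx)).
by rewrite val_unit_ZpM modn_dvdm ?order_dvdG.
Qed.

(** Reduction of exponents modulo #|G| is compatible with reduction modulo the
prime-to-p part of #|G|, because the latter divides #|G|. *)
Lemma Gamma_group_set : group_set (Gamma G p).
Proof.
apply/group_setP; split=> [|s t].
  by rewrite inE /= Zp_cast // (modn_small G_gt1).
rewrite !inE => /eqP s1 /eqP t1; apply/eqP.
rewrite -(modn_dvdm _ (dvdn_part p^' #|G|)) val_unit_ZpM.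
by rewrite modn_dvdm ?dvdn_part // -modnMm s1 t1 modnMm.
Qed.

Lemma GammaV s : s \in Gamma G p -> (s^-1)%g \in Gamma G p.
Proof. by move=> Gs; rewrite (@groupV _ (Group Gamma_group_set)). Qed.

Lemma expg_unit_ZpK x (s : {unit 'Z_#|G|}) : x \in G ->
  ((x ^+ (val s : nat)) ^+ (val s^-1 : nat) = x)%g.
Proof. by move=> Gx; rewrite -expg_unit_ZpM // mulgV expg_unit_Zp1. Qed.

Lemma cfPowM (phi : 'CF(G)) (s t : {unit 'Z_#|G|}) :
  cfPow phi (val (s * t)%g : nat) = cfPow (cfPow phi (val s : nat)) (val t : nat).
Proof.
apply/cfun_inP=> x Gx; rewrite !cfPowE ?groupX //.
by rewrite -expg_unit_ZpM // [(t * s)%g](unit_Zp_mulgC).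
Qed.

Lemma cfPow1 (phi : 'CF(G)) : cfPow phi (val (1%g : {unit 'Z_#|G|}) : nat) = phi.
Proof. by apply/cfun_inP=> x Gx; rewrite cfPowE // expg_unit_Zp1. Qed.

Lemma Gamma_orbit_refl (i : Iirr G) : i \in Gamma_orbit p i.
Proof.
have [Gamma1 _] := group_setP Gamma_group_set.
by rewrite inE; apply/exists_inP; exists 1%g; rewrite ?cfPow1.
Qed.

Lemma Gamma_orbit_sub (i j : Iirr G) : j \in Gamma_orbit p i ->
  Gamma_orbit p j \subset Gamma_orbit p i.
Proof.
rewrite inE => /exists_inP[s Gs /eqP def_j]; apply/subsetP=> k.
have [_ GammaM] := group_setP Gamma_group_set.
rewrite !inE => /exists_inP[t Gt /eqP->]; apply/exists_inP.
by exists (s * t)%g; rewrite ?GammaM // cfPowM def_j.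
Qed.

Lemma Gamma_orbit_sym (i j : Iirr G) :
  j \in Gamma_orbit p i -> i \in Gamma_orbit p j.
Proof.
rewrite !inE => /exists_inP[s Gs /eqP def_j]; apply/exists_inP.
by exists s^-1%g; rewrite ?GammaV // def_j -cfPowM mulgV cfPow1.
Qed.

Lemma Gamma_orbit_eq (i j : Iirr G) :
  j \in Gamma_orbit p i -> Gamma_orbit p j = Gamma_orbit p i.
Proof.
move=> Oj; apply/eqP; rewrite eqEsubset (Gamma_orbit_sub Oj) /=.
exact/Gamma_orbit_sub/Gamma_orbit_sym.
Qed.

(** Orthonormality of irreducible characters turns the norms that define f into
orbit sizes. *)
Lemma cfnorm_unramified_irr (i : Iirr G) :
  '[unramified_irr p i] = #|Gamma_orbit p i|%:R.
Proof.
rewrite cfdot_suml -sum1_card natr_sum; apply: eq_bigr => j Oj.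
rewrite cfdot_sumr (bigD1 j) //= cfnorm_irr big1 ?addr0 // => k /andP[_ k'j].
by rewrite cfdot_irr eq_sym (negPf k'j).
Qed.

Lemma unramified_norm_ordE (i : Iirr G) :
  unramified_norm_ord p i = logn p #|Gamma_orbit p i|.
Proof. by rewrite /unramified_norm_ord cfnorm_unramified_irr natrK. Qed.

(** An invariant phi has the same coefficient on every character of an orbit,
so its expansion over irreducible characters can be regrouped by orbits.
Summing over all of Iirr G rather than over orbit representatives repeats each
orbit sum once per member of the orbit, which is what the denominator
corrects. *)
Lemma unramified_expansion (phi : 'CF(G)) :
  (forall s, s \in Gamma G p -> cfPow phi (val s : nat) = phi) ->
  phi = \sum_i ('[phi, 'chi_i] / #|Gamma_orbit p i|%:R) *: unramified_irr p i.
Proof.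
move=> phiP.
have dot_orbit i j : j \in Gamma_orbit p i -> '[phi, 'chi_j] = '[phi, 'chi_i].
  rewrite inE => /exists_inP[s Gs /eqP->]; rewrite -{1}(phiP s Gs) !cfdotE.
  congr (_ * _).
  (* x |-> x ^+ s permutes G, with inverse the power map of s^-1 *)
  rewrite [RHS](reindex_onto (fun x => x ^+ (val s : nat))%g
                 (fun x => x ^+ (val (s^-1)%g : nat))%g) /=; last first.
    by move=> x Gx; rewrite -{2}(expg_unit_ZpK s^-1 Gx) invgK.
  apply: eq_big => [x | x Gx]; last by rewrite !cfPowE.
  apply/idP/andP=> [Gx | [Gxs /eqP <-]]; last exact: groupX.
  by rewrite groupX // expg_unit_ZpK.
rewrite {1}[phi]cfun_sum_cfdot.
transitivity (\sum_i \sum_(j in Gamma_orbit p i)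
                ('[phi, 'chi_j] / #|Gamma_orbit p j|%:R) *: 'chi_j); last first.
  apply: eq_bigr => i _; rewrite scaler_sumr; apply: eq_bigr => j Oj.
  by rewrite (dot_orbit i) // (Gamma_orbit_eq Oj).
(* in the exchanged sum, 'chi_j is counted once for each i in its orbit *)
rewrite (exchange_big_dep predT) //=; apply: eq_bigr => j _.
rewrite (eq_bigl (mem (Gamma_orbit p j))); last first.
  by move=> i; apply/idP/idP; apply: Gamma_orbit_sym.
rewrite sumr_const -scaler_nat scalerA mulrC divfK //.
by rewrite pnatr_eq0 -lt0n; apply/card_gt0P; exists j; apply: Gamma_orbit_refl.
Qed.

Lemma Gamma_step_inG x y : Gamma_step G p x y -> (x \in G) && (y \in G).
Proof.
case/andP=> Gx /orP[/exists_inP[h Gh /eqP->] | /exists_inP[s _ /eqP->]].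
  by rewrite Gx groupJ.
by rewrite Gx groupX.
Qed.

Lemma Gamma_conj_inG x y : Gamma_conj G p x y -> x \in G -> y \in G.
Proof.
move=> xy Gx; rewrite -(closed_connect _ xy) // => u v /= /orP[] /Gamma_step_inG.
  by case/andP=> -> ->.
by case/andP=> -> ->.
Qed.

Lemma Gamma_conj_step g x y :
  Gamma_step G p x y -> Gamma_conj G p g x = Gamma_conj G p g y.
Proof.
move=> xy; apply: (@connect_closed _ _ _ g) => [u v|]; last by rewrite /= xy.
by apply: sym_connect_sym => u' v' /=; rewrite orbC.
Qed.

Definition Gamma_class g : {set gT} := [set x | Gamma_conj G p g x].

(** Normality is for subsets here, not only for subgroups; it is what makes
'1_(Gamma_class g) the honest indicator function of the class. *)
Lemma Gamma_class_normal g : g \in G -> (Gamma_class g <| G)%g.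
Proof.
move=> Gg; apply/andP; split.
  by apply/subsetP=> x; rewrite inE => /Gamma_conj_inG->.
apply/subsetP=> h Gh; rewrite inE; apply/subsetP=> _ /imsetP[x gx ->].
rewrite !inE in gx *; rewrite -(@Gamma_conj_step g x) //.
rewrite /Gamma_step (Gamma_conj_inG gx Gg); apply/orP; left.
by apply/exists_inP; exists h.
Qed.

Lemma cfPow_Gamma_class g s : g \in G -> s \in Gamma G p ->
  cfPow '1_(Gamma_class g) (val s : nat) = '1_(Gamma_class g) :> 'CF(G).
Proof.
move=> Gg Gs; apply/cfun_inP=> x Gx.
rewrite cfPowE // !cfuniE ?Gamma_class_normal // !inE.
rewrite -(@Gamma_conj_step g x) // /Gamma_step Gx; apply/orP; right.
by apply/exists_inP; exists s.
Qed.

(** Clearing the denominator #|G| leaves a sum of conjugates of values of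
'chi_i, which are themselves character values. *)
Lemma Aint_cfdot_cfuni (A : {set gT}) (i : Iirr G) : (A <| G)%g ->
  #|G|%:R * '['1_A, 'chi_i] \in Aint.
Proof.
move=> nAG; rewrite cfdotE mulVKf ?neq0CG // rpred_sum // => x _.
by rewrite cfuniE // rpredM ?rpred_nat // -char_inv ?irr_char ?Aint_irr.
Qed.

End GammaOrbits.

Theorem proposition3p1 (gT : finGroupType) (G : {group gT}) (p e f : nat)
    (p_prime : prime p) (p_dvd_G : (p %| #|G|)%N)
    (e_def : e = logn p #|G|)
    (f_def : f = max_unramified_norm_ord G p)
    (g1 g2 : gT) (g1_in_G : g1 \in G) (g2_in_G : g2 \in G)
    (congr_chi : forall i : Iirr G,
       (unramified_irr p i g1 == unramified_irr p i g2
          %[mod (p ^ (e + f + 1))%N])%A) :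
  Gamma_conj G p g1 g2.
Proof.
have G_gt1: (1 < #|G|)%N.
  by apply: leq_trans (prime_gt1 p_prime) (dvdn_leq _ p_dvd_G).
have O_gt0 (i : Iirr G) : (0 < #|Gamma_orbit p i|)%N.
  by apply/card_gt0P; exists i; apply: (Gamma_orbit_refl p G_gt1 i).
have le_f (i : Iirr G) : (logn p #|Gamma_orbit p i| <= f)%N.
  by rewrite -unramified_norm_ordE f_def; apply: leq_bigmax.
have [N [N_gt0 logN] O_dvd_N] := common_multiple_logn p_prime O_gt0 le_f.
have nCG := Gamma_class_normal p g1_in_G.
set C := Gamma_class G p g1 in nCG.
apply: contraT => not_conj.
pose phi : 'CF(G) := '1_C.
have phi1 : phi g1 - phi g2 = 1.
  by rewrite !cfuniE // !inE [Gamma_conj _ _ _ _]connect0 (negPf not_conj) subr0.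
suff dvd_NG: ((N * #|G|)%N%:R == 0 %[mod (p ^ (e + f + 1))%N])%A.
  have: (p ^ (e + f + 1) %| N * #|G|)%N by rewrite -eqAmod0_nat.
  rewrite pfactor_dvdn ?muln_gt0 ?N_gt0 ?cardG_gt0 //.
  by rewrite lognM ?cardG_gt0 // logN -e_def (addnC f) addn1 ltnn.
have phi_inv s : s \in Gamma G p -> cfPow phi (val s : nat) = phi.
  exact: cfPow_Gamma_class.
rewrite eqAmod0.
have -> : (N * #|G|)%N%:R = N%:R * #|G|%:R * (phi g1 - phi g2).
  by rewrite phi1 mulr1 natrM.
rewrite (unramified_expansion G_gt1 phi_inv) !sum_cfunE -sumrB mulr_sumr.
apply: rpred_sum => i _.
rewrite !cfunE -mulrBr.
case/dvdnP: (O_dvd_N i) => m ->.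
set a := '[phi, 'chi_i]; set x1 := unramified_irr p i g1.
set x2 := unramified_irr p i g2; set k := #|Gamma_orbit p i|%:R.
have k_neq0 : k != 0 :> algC by rewrite pnatr_eq0 -lt0n.
have -> : (m * #|Gamma_orbit p i|)%N%:R * #|G|%:R * (a / k * (x1 - x2))
        = m%:R * (#|G|%:R * a) * (x1 - x2) by rewrite natrM -/k; field.
rewrite -eqAmod0 -(mulr0 (m%:R * (#|G|%:R * a))).
apply: eqAmodMl; first by rewrite rpredM ?rpred_nat // Aint_cfdot_cfuni.
by rewrite eqAmod0; apply: congr_chi.
Qed.
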